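(* For every infinite set $V$ of variables, $\mathbf L_{FOL}(V)=\langle\mathcal{FOL}_t(V):P_t(V)\in\mathrm{Sig}(V)\rangle$ is a logic family.
   Context: First-order logic $\mathcal{FOL}_t(V)$ for a nonempty relational similarity type $t$ (arities $\ge1$) and variable set $V$: atomic formulas $P_t(V)=\{r(v_1,\dots,v_n):r\in\mathrm{dom}(t),t(r)=n,v_i\in V\}$; connectives binary $\wedge$, unary $\neg$ and $\exists v$ ($v\in V$), constants $\bot$ and $v=w$ ($v,w\in V$); models are $t$-structures $\mathfrak M$ with universe $M$; $\mathrm{mng}_{\mathfrak M}(\phi)=\{h\in{}^VM:\mathfrak M\models\phi[h]\}$; $\mathfrak M\models\phi$ iff $\phi$ holds under all assignments. $\mathrm{Sig}(V)=\{P_t(V): t$ a nonempty relational similarity type$\}$ (each $P_t(V)$ determines $t$). General notions: a logic $\langle F,M,\mathrm{mng},\models\rangle$ has formula algebra $\mathfrak F$ (term algebra over atomic formulas in the connectives), models, validity, and meaning homomorphisms $\mathrm{mng}_{\mathfrak M}$; tautological congruence $\sim=\bigcap_{\mathfrak M}\ker(\mathrm{mng}_{\mathfrak M})$; $\mathrm{Alg}_m(\mathcal L)=\{\mathrm{mng}_{\mathfrak M}(\mathfrak F)\}$. A logic family is $\mathbf L=\langle\mathcal L^P:P\in\mathrm{Sig}\rangle$ with: (1) $P$ is the set of atomic formulas of $\mathcal L^P$; (2) common connectives; (3) $P\subseteq Q$ implies $\mathcal L^P$ is a reduct of $\mathcal L^Q$ (i.e. $\mathfrak F^P\le\mathfrak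 F^Q$ and there is a surjection $M^Q\to M^P$ preserving meanings and validity of formulas in $F^P$); (4) whenever $P\in\mathrm{Sig}$ is the disjoint union of $P_i\in\mathrm{Sig}$ ($i\in I$), $\sim^P=\bigcap\{\ker h: h$ a homomorphism from $\mathfrak F^P$ into a member of $\mathrm{Alg}_m(\mathcal L^P)$ with $\bigcup_i\sim^{P_i}\subseteq\ker h\}$; (5a) for $P\in\mathrm{Sig}$ and any set $H$ there is $P'\in\mathrm{Sig}$ disjoint from $H$ with $\mathcal L^{P'}$ an isomorphic copy of $\mathcal L^P$ (isomorphism = formula-algebra isomorphism plus bijection of models preserving meanings and validity); (5b) for any nonempty family $P_i\in\mathrm{Sig}$ there are pairwise disjoint $P_i'\in\mathrm{Sig}$ with $\mathcal L^{P_i'}$ isomorphic copies of $\mathcal L^{P_i}$ and $\bigcup P_i'\in\mathrm{Sig}$; (5c) $\mathrm{Sig}$ has a nonempty member. *)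

(* Defs.v *)
From Stdlib Require Import List FinFun ClassicalEpsilon ProofIrrelevance FunctionalExtensionality.
From Stdlib Require Fin.

Set Implicit Arguments.
Unset Strict Implicit.

(** Types in [SmallType] play the role of sets; types that need not live in
    [SmallType] play the role of classes.  A predicate on a class is a set when
    it is the range of a function defined on a small type. *)
Definition SmallType := Type.

Definition small {T : Type} (P : T -> Prop) : Prop :=
  exists (A : SmallType) (f : A -> T), forall x, P x <-> exists a, f a = x.

Definition subset {T : Type} (P Q : T -> Prop) : Prop := forall x, P x -> Q x.

Definition disjoint {T : Type} (P Q : T -> Prop) : Prop :=
  forall x, ~ (P x /\ Q x).

Definition pairwise_disjoint {I T : Type} (P : I -> T -> Prop) : Prop :=
  forall i j, i <> j -> disjoint (P i) (P j).

Definition union {I T : Type} (P : I -> T -> Prop) : T -> Prop :=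
  fun x => exists i, P i x.

Lemma subset_union {I T : Type} (P : I -> T -> Prop) (i : I) :
  subset (P i) (union P).
Proof. intros x Hx; exists i; exact Hx. Qed.

Arguments subset_union {I T} P i.

(** * Algebras *)

Record connectives := {
  connective :> Type;
  rank : connective -> nat
}.

Record algebra (C : connectives) := {
  carrier :> Type;
  op : forall c : C, (Fin.t (rank c) -> carrier) -> carrier
}.

Definition is_hom (C : connectives) (A B : algebra C) (f : A -> B) : Prop :=
  forall (c : C) (xs : Fin.t (rank c) -> A),
    f (op xs) = op (fun i => f (xs i)).

(** The kernel of [f] is a congruence of [A]. *)
Definition compositional (C : connectives) (A : algebra C) (Y : Type)
    (f : A -> Y) : Prop :=
  forall (c : C) (xs ys : Fin.t (rank c) -> A),
    (forall i, f (xs i) = f (ys i)) -> f (op xs) = f (op ys).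

Definition image (X Y : Type) (f : X -> Y) : Type := {y : Y | exists x, f x = y}.

Definition to_image (X Y : Type) (f : X -> Y) (x : X) : image f :=
  exist _ (f x) (ex_intro _ x eq_refl).

Definition preimage (X Y : Type) (f : X -> Y) (y : image f) : X :=
  proj1_sig (constructive_indefinite_description _ (proj2_sig y)).

(** The algebra [f(A)].  When [f] is compositional the choice of preimages is
    immaterial and [f] is a homomorphism onto [image_algebra f]
    (see [to_image_hom]). *)
Definition image_algebra (C : connectives) (A : algebra C) (Y : Type)
    (f : A -> Y) : algebra C :=
  {| carrier := image f;
     op := fun c ys => to_image f (op (fun i => preimage (ys i))) |}.

Lemma preimageK (X Y : Type) (f : X -> Y) (y : image f) :
  f (preimage y) = proj1_sig y.
Proof.
  unfold preimage.
  destruct (constructive_indefinite_description _ _) as [x Hx]; exact Hx.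
Qed.

Lemma to_image_hom (C : connectives) (A : algebra C) (Y : Type) (f : A -> Y) :
  compositional f <-> is_hom (B := image_algebra f) (to_image f).
Proof.
  split.
  - intros Hf c xs; apply subset_eq_compat; apply Hf; intro i.
    symmetry; apply (preimageK (to_image f (xs i))).
  - intros Hf c xs ys E.
    assert (E' : (fun i => to_image f (xs i)) = (fun i => to_image f (ys i))).
    { apply functional_extensionality; intro i; apply subset_eq_compat; apply E. }
    assert (H : to_image f (op xs) = to_image f (op ys)).
    { rewrite (Hf c xs), (Hf c ys), E'; reflexivity. }
    exact (f_equal (@proj1_sig _ _) H).
Qed.

(** * Formula algebras *)

Inductive term (C : connectives) (X : Type) : Type :=
| atom (x : X)
| app (c : C) (ts : Fin.t (rank c) -> term C X).

Arguments atom {C X} x.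
Arguments app {C X} c ts.

Fixpoint over (C : connectives) (X : Type) (P : X -> Prop) (phi : term C X)
    : Prop :=
  match phi with
  | atom x => P x
  | app _ ts => forall i, over P (ts i)
  end.

(** All formulas are terms over one class [X] of potential atoms, so that
    [P ⊆ Q] literally makes the formulas over [P] a subalgebra of those
    over [Q]; [formula_incl] is the inclusion. *)
Definition formula (C : connectives) (X : Type) (P : X -> Prop) : Type :=
  {phi : term C X | over P phi}.

Definition formula_algebra (C : connectives) (X : Type) (P : X -> Prop)
    : algebra C :=
  {| carrier := formula C P;
     op := fun c ts =>
       exist (over P) (app c (fun i => proj1_sig (ts i)))
                      (fun i => proj2_sig (ts i)) |}.

Lemma over_subset (C : connectives) (X : Type) (P Q : X -> Prop)
    (PQ : subset P Q) (phi : term C X) : over P phi -> over Q phi.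
Proof.
  induction phi as [x | c ts IH]; simpl; [apply PQ | intros H i; apply IH, H].
Qed.

Definition formula_incl (C : connectives) (X : Type) (P Q : X -> Prop)
    (PQ : subset P Q) (phi : formula_algebra C P) : formula_algebra C Q :=
  exist (over Q) (proj1_sig phi) (over_subset PQ (proj2_sig phi)).

(** * Logics *)

(** A logic with connectives [C], set of atomic formulas [P] and meanings taken
    from the class [Y]. *)
Record logic (C : connectives) (X Y : Type) (P : X -> Prop) := {
  model : Type;
  mng : model -> formula_algebra C P -> Y;
  valid : model -> formula_algebra C P -> Prop;
  mng_compositional : forall M : model, compositional (mng M)
}.

Definition taut_congr (C : connectives) (X Y : Type) (P : X -> Prop)
    (L : logic C Y P) (phi psi : formula_algebra C P) : Prop :=
  forall M : model L, mng M phi = mng M psi.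

Definition Alg_m (C : connectives) (X Y : Type) (P : X -> Prop)
    (L : logic C Y P) (A : algebra C) : Prop :=
  exists M : model L, A = image_algebra (mng M).

Definition reduct (C : connectives) (X Y : Type) (P Q : X -> Prop)
    (PQ : subset P Q) (LP : logic C Y P) (LQ : logic C Y Q) : Prop :=
  exists g : model LQ -> model LP,
    Surjective g /\
    forall (M : model LQ) (phi : formula_algebra C P),
      mng M (formula_incl PQ phi) = mng (g M) phi /\
      (valid M (formula_incl PQ phi) <-> valid (g M) phi).

Definition isomorphic (C : connectives) (X Y : Type) (P Q : X -> Prop)
    (LP : logic C Y P) (LQ : logic C Y Q) : Prop :=
  exists (f : formula_algebra C P -> formula_algebra C Q)
         (g : model LP -> model LQ),
    is_hom f /\ Bijective f /\ Bijective g /\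
    forall (M : model LP) (phi : formula_algebra C P),
      mng M phi = mng (g M) (f phi) /\
      (valid M phi <-> valid (g M) (f phi)).

(** That [P] is the set of atomic formulas of [L P] and that the connectives
    are common is enforced by the type of [L]. *)
Record logic_family (C : connectives) (X Y : Type) (Sig : (X -> Prop) -> Prop)
    (L : forall P, Sig P -> logic C Y P) : Prop := {
  lf_set : forall P, Sig P -> small P;

  lf_reduct : forall P Q (SP : Sig P) (SQ : Sig Q) (PQ : subset P Q),
    reduct PQ (L P SP) (L Q SQ);

  lf_union : forall (I : SmallType) (Pi : I -> X -> Prop)
      (SPi : forall i, Sig (Pi i)) (SP : Sig (union Pi)),
    pairwise_disjoint Pi ->
    forall phi psi : formula_algebra C (union Pi),
      taut_congr (L (union Pi) SP) phi psi <->
      forall (A : algebra C) (h : formula_algebra C (union Pi) -> A),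
        Alg_m (L (union Pi) SP) A ->
        is_hom h ->
        (forall (i : I) (x y : formula_algebra C (Pi i)),
            taut_congr (L (Pi i) (SPi i)) x y ->
            h (formula_incl (subset_union Pi i) x) =
            h (formula_incl (subset_union Pi i) y)) ->
        h phi = h psi;

  lf_copy : forall P (SP : Sig P) (H : X -> Prop), small H ->
    exists P' (SP' : Sig P'),
      disjoint P' H /\ isomorphic (L P SP) (L P' SP');

  lf_copies : forall (I : SmallType) (Pi : I -> X -> Prop)
      (SPi : forall i, Sig (Pi i)),
    inhabited I ->
    exists (Pi' : I -> X -> Prop) (SPi' : forall i, Sig (Pi' i)),
      pairwise_disjoint Pi' /\
      (forall i, isomorphic (L (Pi i) (SPi i)) (L (Pi' i) (SPi' i))) /\
      Sig (union Pi');

  lf_nonempty : exists P, Sig P /\ exists x, P x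
}.

(** * First-order logic *)

(** Relation symbols: elements of arbitrary sets.  They form a proper class. *)
Definition symbol : Type := {A : SmallType & A}.

(** Nonempty relational similarity types; [arity r = None] means that [r] is
    not in the domain. *)
Record simtype := {
  arity :> symbol -> option nat;
  arity_pos : forall r n, arity r = Some n -> 1 <= n;
  dom_small : small (fun r => arity r <> None);
  dom_nonempty : exists r, arity r <> None
}.

Inductive fol_connective (V : Type) : Type :=
| c_and
| c_not
| c_ex (v : V)
| c_bot
| c_eq (v w : V).

Definition fol_rank (V : Type) (c : fol_connective V) : nat :=
  match c with
  | c_and _ => 2
  | c_not _ => 1
  | c_ex _ => 1
  | c_bot _ => 0
  | c_eq _ _ => 0
  end.

Definition fol_connectives (V : Type) : connectives :=
  {| connective := fol_connective V; rank := @fol_rank V |}.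

(** [(r, v1 :: ... :: vn :: nil)] stands for [r(v1, ..., vn)]. *)
Definition fol_atom (V : Type) : Type := (symbol * list V)%type.

Definition P_ (V : Type) (t : simtype) : fol_atom V -> Prop :=
  fun a => t (fst a) = Some (length (snd a)).

Arguments P_ V t a : clear implicits.

(** [rel r] is a set of tuples of the length prescribed by [t]; it is empty
    when [r] is not in the domain of [t], so that a structure carries no
    information about other symbols. *)
Record structure (t : simtype) := {
  universe : SmallType;
  universe_nonempty : inhabited universe;
  rel : symbol -> list universe -> Prop;
  rel_arity : forall r xs, rel r xs -> t r = Some (length xs)
}.

Fixpoint sat (V : Type) (t : simtype) (M : structure t)
    (phi : term (fol_connectives V) (fol_atom V)) (h : V -> universe M) : Prop :=
  match phi with
  | atom a => rel (fst a) (map h (snd a))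
  | app c ts =>
      match c as c0
        return (Fin.t (fol_rank c0) -> term (fol_connectives V) (fol_atom V)) -> Prop
      with
      | c_and _ => fun ts => sat (ts Fin.F1) h /\ sat (ts (Fin.FS Fin.F1)) h
      | c_not _ => fun ts => ~ sat (ts Fin.F1) h
      | c_ex v => fun ts =>
          exists h' : V -> universe M, (forall w, w <> v -> h' w = h w) /\ sat (ts Fin.F1) h'
      | c_bot _ => fun _ => False
      | c_eq v w => fun _ => h v = h w
      end ts
  end.

(** Sets of assignments of [V] into some set. *)
Definition fol_meaning (V : SmallType) : Type :=
  {M : SmallType & (V -> M) -> Prop}.

Definition fol_mng (V : SmallType) (t : simtype) (M : structure t)
    (phi : formula_algebra (fol_connectives V) (P_ V t)) : fol_meaning V :=
  existT _ (universe M) (fun h => sat (proj1_sig phi) h).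

Definition fol_valid (V : SmallType) (t : simtype) (M : structure t)
    (phi : formula_algebra (fol_connectives V) (P_ V t)) : Prop :=
  forall h : V -> universe M, sat (proj1_sig phi) h.

Lemma fol_mng_compositional (V : SmallType) (t : simtype) (M : structure t) :
  compositional (@fol_mng V t M).
Proof.
  intros c xs ys E.
  assert (E' : forall i, (fun h : V -> universe M => sat (proj1_sig (xs i)) h) =
                         (fun h : V -> universe M => sat (proj1_sig (ys i)) h)).
  { intro i; exact (inj_pair2 _ _ _ _ _ (E i)). }
  assert (E'' : forall i (h : V -> universe M),
             sat (proj1_sig (xs i)) h = sat (proj1_sig (ys i)) h).
  { intros i h; exact (f_equal (fun S => S h) (E' i)). }
  unfold fol_mng; f_equal; apply functional_extensionality; intro h.
  clear E E'.
  destruct c; simpl in *; try reflexivity.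
  - now rewrite !E''.
  - now rewrite !E''.
  - f_equal; apply functional_extensionality; intro h'; now rewrite E''.
Qed.

Definition FOL (V : SmallType) (t : simtype)
    : logic (fol_connectives V) (fol_meaning V) (P_ V t) :=
  {| model := structure t;
     mng := @fol_mng V t;
     valid := @fol_valid V t;
     mng_compositional := @fol_mng_compositional V t |}.

Definition FOL_Sig (V : SmallType) (P : fol_atom V -> Prop) : Prop :=
  exists t : simtype, P_ V t = P.

(** [P_ V t] determines [t] when [V] is inhabited, so the similarity type picked
    here is the only possible one (see [FOL_family_P_]). *)
Definition FOL_family (V : SmallType) (P : fol_atom V -> Prop) (SP : FOL_Sig P)
    : logic (fol_connectives V) (fol_meaning V) P :=
  let (t, E) := constructive_indefinite_description _ SP in
  eq_rect (P_ V t) (logic (fol_connectives V) (fol_meaning V)) (FOL V t) P E.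

Arguments FOL_family V P SP : clear implicits.

Lemma P_inj (V : SmallType) (t u : simtype) :
  inhabited V -> P_ V t = P_ V u -> t = u.
Proof.
  intros [v] E.
  assert (K : forall r n, t r = Some n <-> u r = Some n).
  { intros r n.
    assert (H := f_equal (fun P => P (r, repeat v n)) E).
    unfold P_ in H; simpl in H; rewrite repeat_length in H.
    rewrite H; tauto. }
  assert (A : arity t = arity u).
  { apply functional_extensionality; intro r.
    destruct (t r) as [n|] eqn:Et.
    - symmetry; now apply K.
    - destruct (u r) as [n|] eqn:Eu; [|reflexivity].
      apply K in Eu; congruence. }
  destruct t as [a p d e], u as [a' p' d' e']; simpl in A; subst a'.
  now rewrite (proof_irrelevance _ p p'), (proof_irrelevance _ d d'),
    (proof_irrelevance _ e e').
Qed.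

Lemma FOL_family_P_ (V : SmallType) (t : simtype) (S : FOL_Sig (P_ V t)) :
  inhabited V -> FOL_family V (P_ V t) S = FOL V t.
Proof.
  intro iV; unfold FOL_family.
  destruct (constructive_indefinite_description _ S) as [u E].
  assert (U := P_inj iV E); subst u.
  now rewrite (proof_irrelevance _ E eq_refl).
Qed.

(* Main.v *)
Require Import Defs.
From Stdlib Require Import FinFun.
From Stdlib Require Import List ClassicalEpsilon ProofIrrelevance.
From Stdlib Require Import FunctionalExtensionality PropExtensionality.
Import ListNotations.

Set Implicit Arguments.
Unset Strict Implicit.

(** For the union condition, a homomorphism [h] from the formulas over the union
    into the meaning algebra of [M] sends each atom [r(v1, ..., vn)] to a set of
    assignments with finite support, since it is the meaning of a formula in [M].
    The tautologies [r(v) <-> exists w, r(v)], for [w] not among the [v], cut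
    this support down to the [v].  The tautologies [r(v) /\ v = u <-> r(u) /\ v = u],
    used with [u] fresh (this is where [V] is infinite), show that all the sets
    [h(r(v))] come from one relation on the universe of [M].  Each of these
    tautologies concerns a single symbol, hence lives in a single summand.  So [h]
    is the meaning function of another structure on the same universe, and it
    identifies tautologically equivalent formulas.

    Disjoint copies are obtained by renaming symbols; Cantor's argument gives
    symbols outside any given set. *)

(** * Fresh variables and assignments *)

Section Assignments.

Variables (V U : Type).

Lemma infinite_inhabited : ~ Finite V -> inhabited V.
Proof.
  intro inf; apply NNPP; intro no; apply inf; exists [].
  intro v; exfalso; apply no; constructor; exact v.
Qed.

Lemma fresh_variable (l : list V) : ~ Finite V -> exists v, ~ In v l.
Proof.
  intro inf; apply NNPP; intro no; apply inf; exists l.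
  intro v; apply NNPP; intro Hv; apply no; now exists v.
Qed.

Lemma fresh_variables (l : list V) (n : nat) :
  ~ Finite V ->
  exists us, length us = n /\ NoDup us /\ forall u, In u us -> ~ In u l.
Proof.
  intro inf; induction n as [|n [us [Hlen [Hnd Hfr]]]].
  - exists []; repeat split; [constructor | intros u []].
  - destruct (fresh_variable (us ++ l) inf) as [u Hu].
    rewrite in_app_iff in Hu.
    exists (u :: us); simpl; repeat split.
    + now rewrite Hlen.
    + constructor; tauto.
    + intros u' [<- | Hu']; [tauto | now apply Hfr].
Qed.

Lemma assignment_update (k : V -> U) (v : V) (x : U) :
  exists k', k' v = x /\ forall w, w <> v -> k' w = k w.
Proof.
  exists (fun w => if excluded_middle_informative (w = v) then x else k w).
  split; [|intros w Hw]; destruct (excluded_middle_informative _); congruence.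
Qed.

Lemma assignment_updates (k : V -> U) (us : list V) (xs : list U) :
  NoDup us -> length us = length xs ->
  exists k', map k' us = xs /\ forall w, ~ In w us -> k' w = k w.
Proof.
  revert xs; induction us as [|u us IH]; intros [|x xs] Hnd Hlen; try discriminate.
  - now exists k.
  - inversion Hnd as [|? ? Hu Hus]; subst.
    destruct (IH xs Hus) as [k1 [H1 H2]]; [now injection Hlen|].
    destruct (assignment_update k1 u x) as [k2 [H3 H4]].
    exists k2; simpl; split.
    + rewrite H3; f_equal; rewrite <- H1; apply map_ext_in.
      intros w Hw; apply H4; intros ->; contradiction.
    + intros w Hw; rewrite H4 by (intros ->; tauto); apply H2; tauto.
Qed.

(** One implication suffices: the assumption on [k] and [k'] is symmetric, so membership in [S]
    depends only on the values on [l]. *)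
Definition finitely_supported (S : (V -> U) -> Prop) : Prop :=
  exists l : list V, forall k k', (forall v, In v l -> k v = k' v) -> S k -> S k'.

Lemma map_eq_in (k k' : V -> U) (vs : list V) :
  map k vs = map k' vs -> forall v, In v vs -> k v = k' v.
Proof.
  induction vs as [|w vs IH]; simpl; [tauto|].
  intros E v [<- | Hv]; injection E; auto.
Qed.

End Assignments.

(** * The full cylindric set algebra *)

Definition set_algebra (V U : Type) : algebra (fol_connectives V) :=
  {| carrier := (V -> U) -> Prop;
     op := fun c : fol_connectives V =>
       match c as c0 return (Fin.t (fol_rank c0) -> (V -> U) -> Prop) -> (V -> U) -> Prop with
       | c_and _ => fun xs k => xs Fin.F1 k /\ xs (Fin.FS Fin.F1) k
       | c_not _ => fun xs k => ~ xs Fin.F1 k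
       | c_ex v => fun xs k => exists k', (forall w, w <> v -> k' w = k w) /\ xs Fin.F1 k'
       | c_bot _ => fun _ _ => False
       | c_eq v w => fun _ k => k v = k w
       end |}.

(** The operations of [set_algebra] are the clauses of [sat], so both sides agree by computation. *)
Lemma sat_hom (V : Type) (P : fol_atom V -> Prop) (t : simtype) (M : structure t) :
  is_hom (A := formula_algebra (fol_connectives V) P) (B := set_algebra V (universe M))
    (fun phi => @sat V t M (proj1_sig phi)).
Proof. intros [] xs; reflexivity. Qed.

Lemma formula_incl_hom (C : connectives) (X : Type) (P Q : X -> Prop) (PQ : subset P Q) :
  is_hom (@formula_incl C X P Q PQ).
Proof. intros c xs; now apply subset_eq_compat. Qed.

Lemma hom_comp (C : connectives) (A B D : algebra C) (f : A -> B) (g : B -> D) :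
  is_hom f -> is_hom g -> is_hom (fun x => g (f x)).
Proof. intros Hf Hg c xs; now rewrite Hf, Hg. Qed.

Definition atomic (C : connectives) (X : Type) (P : X -> Prop) (a : X) (Pa : P a)
  : formula_algebra C P := exist (over P) (atom a) Pa.

Arguments atomic {C X P} a Pa.

Lemma formula_incl_atomic (C : connectives) (X : Type) (P Q : X -> Prop)
    (PQ : subset P Q) (a : X) (Pa : P a) (Qa : Q a) :
  formula_incl PQ (atomic (C := C) a Pa) = atomic a Qa.
Proof. now apply subset_eq_compat. Qed.

Lemma hom_ext (C : connectives) (X : Type) (P : X -> Prop) (B : algebra C)
    (f g : formula_algebra C P -> B) :
  is_hom f -> is_hom g ->
  (forall a (Pa : P a), f (atomic a Pa) = g (atomic a Pa)) ->
  forall phi, f phi = g phi.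
Proof.
  intros Hf Hg Hat [phi Hphi].
  induction phi as [a | c ts IH]; [apply Hat|].
  (* The subterms are repackaged as elements of the formula algebra, so that the homomorphism
     property applies. *)
  pose (xs := fun i => exist (over P) (ts i) (Hphi i) : formula_algebra C P).
  change (f (op xs) = g (op xs)).
  rewrite Hf, Hg; f_equal; apply functional_extensionality; intro i; apply IH.
Qed.

Lemma sat_finitely_supported (V : Type) (t : simtype) (M : structure t)
    (phi : term (fol_connectives V) (fol_atom V)) :
  finitely_supported (@sat V t M phi).
Proof.
  induction phi as [[r vs] | c ts IH].
  - exists vs; simpl; intros k k' E; now rewrite (map_ext_in k k' vs E).
  - destruct c; simpl in *.
    + destruct (IH Fin.F1) as [l1 H1], (IH (Fin.FS Fin.F1)) as [l2 H2].
      exists (l1 ++ l2); intros k k' E [S1 S2]; split;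
        [apply (H1 k) | apply (H2 k)]; auto;
        intros v Hv; apply E; rewrite in_app_iff; auto.
    + destruct (IH Fin.F1) as [l H]; exists l; intros k k' E S S'; apply S.
      apply (H k'); auto; intros v Hv; symmetry; auto.
    + destruct (IH Fin.F1) as [l H]; exists l; intros k k' E [k1 [E1 S]].
      (* The witness for [k'] copies the value of [k1] at [v] and equals [k'] elsewhere, hence
         agrees with [k1] on [l]. *)
      destruct (assignment_update k' v (k1 v)) as [k2 [E2 E3]].
      exists k2; split; [exact E3|]; apply (H k1); [|exact S].
      intros w Hw; destruct (classic (w = v)) as [-> | Hwv]; [now rewrite E2|].
      rewrite E1, E3; auto.
    + exists []; tauto.
    + exists [v; w]; intros k k' E; now rewrite <- !E by (simpl; auto).
Qed.

(** * Homomorphisms respecting the tautologies *)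

Section Connectives.

Variables (V : Type) (P : fol_atom V -> Prop).
Notation F := (formula_algebra (fol_connectives V) P).

Definition f_and (x y : F) : F :=
  @op _ F (c_and V) (fun i => match i with Fin.F1 => x | _ => y end).
Definition f_ex (v : V) (x : F) : F := @op _ F (c_ex v) (fun _ => x).
Definition f_eq (v w : V) : F := @op _ F (c_eq v w) (Fin.case0 _).
Definition f_true : F := @op _ F (c_not V) (fun _ => @op _ F (c_bot V) (Fin.case0 _)).

(** The conjunction of the equations between paired entries. It stops at the end of the shorter
    list, hence the length hypotheses below. *)
Fixpoint f_eqs (vs ws : list V) : F :=
  match vs, ws with
  | v :: vs, w :: ws => f_and (f_eq v w) (f_eqs vs ws)
  | _, _ => f_true
  end.

Variables (U : Type) (G : F -> set_algebra V U).
Hypothesis G_hom : is_hom G.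

(** Stated for any homomorphism [G], so as to serve both for satisfaction in a structure and for the
    homomorphism of the union condition. *)
Lemma hom_and x y k : G (f_and x y) k <-> G x k /\ G y k.
Proof. unfold f_and; rewrite G_hom; reflexivity. Qed.

Lemma hom_ex v x k :
  G (f_ex v x) k <-> exists k', (forall w, w <> v -> k' w = k w) /\ G x k'.
Proof. unfold f_ex; rewrite G_hom; reflexivity. Qed.

Lemma hom_eq v w k : G (f_eq v w) k <-> k v = k w.
Proof. unfold f_eq; rewrite G_hom; reflexivity. Qed.

Lemma hom_true k : G f_true k.
Proof. unfold f_true; rewrite !G_hom; exact id. Qed.

Lemma hom_eqs vs ws k :
  length vs = length ws -> (G (f_eqs vs ws) k <-> map k vs = map k ws).
Proof.
  revert ws; induction vs as [|v vs IH]; intros [|w ws] E; try discriminate; simpl.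
  - split; [reflexivity | intros _; apply hom_true].
  - rewrite hom_and, hom_eq, IH by (now injection E).
    split; [intros [-> ->]; reflexivity | intro H; injection H; auto].
Qed.

End Connectives.

(** * Coherence of the values at the atoms of one symbol *)

Section Coherence.

Variables (V : Type) (t : simtype).
Notation F := (formula_algebra (fol_connectives V) (P_ V t)).

(** The tautological congruence of [FOL V t], unfolded so that no equality of dependent pairs
    appears. *)
Definition equivalent (x y : F) : Prop :=
  forall (M : structure t) (k : V -> universe M),
    sat (proj1_sig x) k <-> sat (proj1_sig y) k.

Lemma equivalent_ex (a : fol_atom V) (Pa : P_ V t a) (v : V) :
  ~ In v (snd a) -> equivalent (atomic a Pa) (f_ex v (atomic a Pa)).
Proof.
  intros Hv M k; destruct a as [r vs]; simpl; split.
  - intro S; now exists k.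
  - intros [k' [E S]]; rewrite <- (map_ext_in k' k vs); auto.
    intros w Hw; apply E; intros ->; contradiction.
Qed.

Lemma equivalent_subst (r : symbol) (vs ws : list V)
    (Pv : P_ V t (r, vs)) (Pw : P_ V t (r, ws)) :
  length vs = length ws ->
  equivalent (f_and (atomic (r, vs) Pv) (f_eqs _ vs ws))
             (f_and (atomic (r, ws) Pw) (f_eqs _ vs ws)).
Proof.
  intros E M k.
  rewrite !(hom_and (@sat_hom V (P_ V t) t M)), (hom_eqs (@sat_hom V (P_ V t) t M) k E).
  simpl; split; intros [S K]; split; auto; congruence.
Qed.

Variables (U : Type) (G : F -> set_algebra V U).
Hypothesis G_hom : is_hom G.
Hypothesis G_fin : forall x, finitely_supported (G x).
Hypothesis G_equiv : forall x y, equivalent x y -> G x = G y.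
Hypothesis infinite_V : ~ Finite V.

(** By finite support it is enough to change [k] into [k'] on a finite list, one variable at a
    time. *)
Lemma atom_support (a : fol_atom V) (Pa : P_ V t a) (k k' : V -> U) :
  map k (snd a) = map k' (snd a) -> G (atomic a Pa) k -> G (atomic a Pa) k'.
Proof.
  intros E S; destruct (G_fin (atomic a Pa)) as [l Hl].
  assert (K : exists k2, map k2 (snd a) = map k' (snd a) /\
              (forall v, In v l -> k2 v = k' v) /\ G (atomic a Pa) k2).
  { clear Hl; induction l as [|d l [k2 [E1 [E2 S2]]]].
    - exists k; repeat split; auto; intros v [].
    - destruct (assignment_update k2 d (k' d)) as [k3 [E3 E4]].
      exists k3; repeat split.
      + apply map_ext_in; intros v Hv.
        destruct (classic (v = d)) as [-> | Hd]; [exact E3|].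
        rewrite E4 by exact Hd; now apply (map_eq_in E1).
      + intros v [<- | Hv]; [exact E3|].
        destruct (classic (v = d)) as [-> | Hd]; [exact E3|].
        rewrite E4 by exact Hd; auto.
      (* If [d] occurs in the atom, [k2] already has the right value there and the update changes
         nothing; otherwise the atom is exchanged for its quantification over [d]. *)
      + destruct (classic (In d (snd a))) as [Hd | Hd].
        * replace k3 with k2; [exact S2|].
          apply functional_extensionality; intro v.
          destruct (classic (v = d)) as [-> | Hv]; [|now rewrite E4].
          rewrite E3; now apply (map_eq_in E1).
        * rewrite (G_equiv (equivalent_ex Pa Hd)); apply (hom_ex G_hom).
          exists k2; split; [|exact S2]; intros w Hw; now rewrite E4. }
  destruct K as [k2 [_ [E2 S2]]]; exact (Hl k2 k' E2 S2).
Qed.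

(** The conjunct [f_eqs _ vs ws] holds at [k]; once it is added, the two atoms may be exchanged. *)
Lemma atom_subst (r : symbol) (vs ws : list V)
    (Pv : P_ V t (r, vs)) (Pw : P_ V t (r, ws)) (k : V -> U) :
  map k vs = map k ws -> G (atomic (r, vs) Pv) k -> G (atomic (r, ws) Pw) k.
Proof.
  intros E S.
  assert (L : length vs = length ws).
  { rewrite <- (length_map k vs), E; apply length_map. }
  apply (hom_and G_hom (atomic (r, ws) Pw) (f_eqs _ vs ws)).
  rewrite <- (G_equiv (equivalent_subst Pv Pw L)).
  apply (hom_and G_hom); split; [exact S|]; now apply (hom_eqs G_hom).
Qed.

(** [vs] and [ws] may overlap, so there may be no assignment agreeing with [k] on [vs] and with [k']
    on [ws]. Fresh variables [us] provide an intermediate atom. *)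
Lemma atom_coherent (r : symbol) (vs ws : list V)
    (Pv : P_ V t (r, vs)) (Pw : P_ V t (r, ws)) (k k' : V -> U) :
  map k vs = map k' ws -> G (atomic (r, vs) Pv) k -> G (atomic (r, ws) Pw) k'.
Proof.
  intros E S.
  destruct (fresh_variables (vs ++ ws) (length vs) infinite_V) as [us [Lu [Nu Fu]]].
  assert (L : length vs = length ws).
  { rewrite <- (length_map k vs), E; apply length_map. }
  assert (Pu : P_ V t (r, us)).
  { unfold P_ in *; simpl in *; congruence. }
  destruct (@assignment_updates V U k us (map k vs) Nu) as [k1 [E1 A1]].
  { now rewrite length_map. }
  destruct (@assignment_updates V U k' us (map k' ws) Nu) as [k2 [E2 A2]].
  { rewrite length_map; congruence. }
  assert (B1 : map k1 vs = map k vs).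
  { apply map_ext_in; intros v Hv; apply A1; intro Hu; apply (Fu v Hu).
    rewrite in_app_iff; auto. }
  assert (B2 : map k2 ws = map k' ws).
  { apply map_ext_in; intros v Hv; apply A2; intro Hu; apply (Fu v Hu).
    rewrite in_app_iff; auto. }
  (* The chain [(vs, k)], [(vs, k1)], [(us, k1)], [(us, k2)], [(ws, k2)], [(ws, k')] is followed
     from its end. *)
  apply (@atom_support (r, ws) Pw k2 k' B2).
  apply (@atom_subst r us ws Pu Pw); [congruence|].
  apply (@atom_support (r, us) Pu k1 k2); [simpl; congruence|].
  apply (@atom_subst r vs us Pv Pu); [congruence|].
  apply (@atom_support (r, vs) Pv k k1); [simpl; congruence | exact S].
Qed.

End Coherence.

(** * Gluing the summands into one structure *)

Section Gluing.

Variables (V : Type) (t : simtype) (I : Type) (ti : I -> simtype).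
Hypothesis sub : forall i, subset (P_ V (ti i)) (P_ V t).
Hypothesis cover : forall a, P_ V t a -> exists i, P_ V (ti i) a.
Hypothesis infinite_V : ~ Finite V.
Variables (U : SmallType) (G : formula_algebra (fol_connectives V) (P_ V t) -> set_algebra V U).
Hypothesis inhabited_U : inhabited U.
Hypothesis G_hom : is_hom G.
Hypothesis G_fin : forall x, finitely_supported (G x).
Hypothesis G_equiv : forall i x y, equivalent x y ->
  G (formula_incl (@sub i) x) = G (formula_incl (@sub i) y).

(** Read off from the values of [G] at atoms; coherence makes the choice of [vs] and [k]
    immaterial. *)
Definition glued_rel (r : symbol) (xs : list U) : Prop :=
  exists (vs : list V) (Pv : P_ V t (r, vs)) (k : V -> U),
    map k vs = xs /\ G (atomic (r, vs) Pv) k.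

Lemma glued_rel_arity r xs : glued_rel r xs -> t r = Some (length xs).
Proof. intros [vs [Pv [k [<- _]]]]; rewrite length_map; exact Pv. Qed.

Definition glued : structure t :=
  {| universe := U; universe_nonempty := inhabited_U;
     rel := glued_rel; rel_arity := glued_rel_arity |}.

(** [G] is assumed to respect equivalences within a summand, so coherence is applied to its
    restriction [Gi] to a summand containing [r]. *)
Lemma glued_atom (r : symbol) (ws : list V) (Pw : P_ V t (r, ws)) (k : V -> U) :
  glued_rel r (map k ws) <-> G (atomic (r, ws) Pw) k.
Proof.
  split; [|intro S; exists ws, Pw, k; auto].
  intros [vs [Pv [k' [E S]]]].
  destruct (cover Pw) as [i Qw].
  (* Both variable lists have the length of the same tuple, so the second atom lies in the same
     summand. *)
  assert (Qv : P_ V (ti i) (r, vs)).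
  { unfold P_ in *; simpl in *; rewrite Qw.
    now rewrite <- (length_map k' vs), E, length_map. }
  pose (Gi := fun x => G (formula_incl (@sub i) x)).
  assert (K : Gi (atomic (r, ws) Qw) k).
  { apply (@atom_coherent V (ti i) U Gi) with (vs := vs) (Pv := Qv) (k := k'); auto.
    - exact (hom_comp (formula_incl_hom (@sub i)) G_hom).
    - intro x; apply G_fin.
    - intros x y; apply G_equiv.
    - unfold Gi; now rewrite (formula_incl_atomic _ (@sub i) Qv Pv). }
  unfold Gi in K; now rewrite (formula_incl_atomic _ (@sub i) Qw Pw) in K.
Qed.

Lemma glued_sat (phi : formula_algebra (fol_connectives V) (P_ V t)) :
  G phi = @sat V t glued (proj1_sig phi).
Proof.
  revert phi; apply hom_ext; [exact G_hom | exact (@sat_hom V (P_ V t) t glued)|].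
  intros [r vs] Pa; apply functional_extensionality; intro k.
  apply propositional_extensionality; symmetry; apply (glued_atom Pa).
Qed.

End Gluing.

(** * The union condition for [FOL] *)

Lemma fol_mng_eq (V : SmallType) (t : simtype) (M : structure t)
    (x y : formula_algebra (fol_connectives V) (P_ V t)) :
  fol_mng M x = fol_mng M y <->
  forall k : V -> universe M, sat (proj1_sig x) k <-> sat (proj1_sig y) k.
Proof.
  split.
  - intros E k; assert (E' := inj_pair2 _ _ _ _ _ E).
    assert (E'' := f_equal (fun S => S k) E'); simpl in E''; now rewrite E''.
  - intro E; unfold fol_mng; f_equal; apply functional_extensionality; intro k.
    now apply propositional_extensionality.
Qed.

(** Up to the encoding of the image algebra, [h] is a map [G] into the set algebra on the universe
    of [M], and [G] is satisfaction in the glued structure. *)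
Lemma FOL_union (V : SmallType) (t : simtype) (I : Type) (ti : I -> simtype)
    (sub : forall i, subset (P_ V (ti i)) (P_ V t)) :
  (forall a, P_ V t a -> exists i, P_ V (ti i) a) -> ~ Finite V ->
  forall (phi psi : formula_algebra (fol_connectives V) (P_ V t))
    (A : algebra (fol_connectives V)) (h : formula_algebra (fol_connectives V) (P_ V t) -> A),
  Alg_m (FOL V t) A -> is_hom h ->
  (forall i x y, equivalent x y ->
     h (formula_incl (sub i) x) = h (formula_incl (sub i) y)) ->
  equivalent phi psi -> h phi = h psi.
Proof.
  intros cover inf phi psi A h [M ->] Hh Heq Hphi.
  change (structure t) in M.
  (* Each value of [h] is the meaning in [M] of some formula; [G x] is the satisfaction set of one
     such formula, which gives finite support. *)
  pose (G := fun x k => @sat V t M (proj1_sig (preimage (h x))) k).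
  assert (hG : forall x, proj1_sig (h x) = existT _ (universe M) (G x)).
  { intro x; exact (eq_sym (preimageK (h x))). }
  assert (G_hom : is_hom (B := set_algebra V (universe M)) G).
  (* The chosen preimages need not commute with [op], but the operation of the image algebra is
     computed from them, so their meanings do. *)
  { intros c xs; assert (E := hG (op xs)); rewrite Hh in E.
    apply inj_pair2 in E; rewrite <- E.
    exact (@sat_hom V (P_ V t) t M c (fun i => preimage (h (xs i)))). }
  assert (K : G phi = G psi).
  { assert (G_fin : forall x, finitely_supported (G x)).
    { intro x; apply sat_finitely_supported. }
    assert (G_equiv : forall i x y, equivalent x y ->
              G (formula_incl (sub i) x) = G (formula_incl (sub i) y)).
    { intros i x y E; unfold G; now rewrite (Heq i x y E). }
    rewrite !(glued_sat cover inf (universe_nonempty M) G_hom G_fin G_equiv).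
    apply functional_extensionality; intro k.
    apply propositional_extensionality; apply Hphi. }
  assert (E : proj1_sig (h phi) = proj1_sig (h psi)) by (now rewrite !hG, K).
  destruct (h phi) as [a Ha], (h psi) as [b Hb]; now apply subset_eq_compat.
Qed.

(** * Renaming of symbols *)

Fixpoint rename (V : Type) (s : symbol -> symbol)
    (phi : term (fol_connectives V) (fol_atom V))
    : term (fol_connectives V) (fol_atom V) :=
  match phi with
  | atom a => atom (s (fst a), snd a)
  | Defs.app c ts => Defs.app c (fun i => rename s (ts i))
  end.

Definition preserves_arity (t u : simtype) (s : symbol -> symbol) : Prop :=
  forall r n, t r = Some n -> u (s r) = Some n.

(** The maps are total on symbols, so [s'] is asked to invert [s] only on the domain of [t]. *)
Definition retraction (t : simtype) (s s' : symbol -> symbol) : Prop :=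
  forall r, t r <> None -> s' (s r) = r.

Lemma over_rename (V : Type) (t u : simtype) (s : symbol -> symbol)
    (phi : term (fol_connectives V) (fol_atom V)) :
  preserves_arity t u s -> over (P_ V t) phi -> over (P_ V u) (rename s phi).
Proof.
  intro Hs; induction phi as [[r vs] | c ts IH]; simpl; [apply Hs | auto].
Qed.

Lemma rename_cancel (V : Type) (t : simtype) (s s' : symbol -> symbol)
    (phi : term (fol_connectives V) (fol_atom V)) :
  retraction t s s' -> over (P_ V t) phi -> rename s' (rename s phi) = phi.
Proof.
  intro Hs; induction phi as [[r vs] | c ts IH]; simpl; intro H.
  - rewrite Hs; [reflexivity|]; unfold P_ in H; simpl in H; congruence.
  - f_equal; apply functional_extensionality; auto.
Qed.

Lemma rename_id (V : Type) (phi : term (fol_connectives V) (fol_atom V)) :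
  rename (fun r => r) phi = phi.
Proof.
  induction phi as [[r vs] | c ts IH]; simpl; [reflexivity|].
  f_equal; now apply functional_extensionality.
Qed.

(** With [s] the identity this is a reduct or an expansion by empty relations. *)
Definition pullback (t u : simtype) (s : symbol -> symbol) (M : structure t)
    : structure u :=
  {| universe := universe M;
     universe_nonempty := universe_nonempty M;
     rel := fun r xs => @rel t M (s r) xs /\ u r = Some (length xs);
     rel_arity := fun r xs H => proj2 H |}.

Arguments pullback {t} u s M.

Lemma sat_pullback (V : Type) (t u : simtype) (s : symbol -> symbol) (M : structure t)
    (phi : term (fol_connectives V) (fol_atom V)) :
  over (P_ V u) phi ->
  forall k : V -> universe M,
    @sat V u (pullback u s M) phi k <-> @sat V t M (rename s phi) k.
Proof.
  induction phi as [[r vs] | c ts IH]; simpl; intros H k.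
  - unfold P_ in H; simpl in H; rewrite length_map; tauto.
  - destruct c; simpl in *; try tauto.
    + now rewrite !IH.
    + now rewrite !IH.
    + split; intros [k' [E S]]; exists k'; split; auto; now apply IH.
Qed.

Lemma structure_ext (t : simtype) (U : SmallType) (ne ne' : inhabited U)
    (R R' : symbol -> list U -> Prop)
    (ar : forall r xs, R r xs -> t r = Some (length xs))
    (ar' : forall r xs, R' r xs -> t r = Some (length xs)) :
  (forall r xs, R r xs <-> R' r xs) ->
  Build_structure ne ar = Build_structure ne' ar'.
Proof.
  intro H.
  assert (E : R = R').
  { apply functional_extensionality; intro r; apply functional_extensionality; intro xs.
    now apply propositional_extensionality. }
  subst R'; now rewrite (proof_irrelevance _ ne ne'), (proof_irrelevance _ ar ar').
Qed.

(** Equality is literal: by [rel_arity] the relations of [M] are empty outside the prescribed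
    arities, so the arity clauses of [pullback] remove nothing. *)
Lemma pullback_cancel (t u : simtype) (s s' : symbol -> symbol) (M : structure t) :
  preserves_arity t u s -> retraction t s s' ->
  pullback t s (pullback u s' M) = M.
Proof.
  intros Hs Hr; destruct M as [U ne R ar]; apply structure_ext; simpl.
  intros r xs; split.
  - intros [[H _] Ht]; rewrite Hr in H by congruence; exact H.
  - intro H; assert (Ht := ar r xs H).
    rewrite Hr by congruence; repeat split; auto.
Qed.

(** Relating [psi] to [phi] by an equation lets one lemma serve inclusions, with [s] the identity,
    as well as renamings. *)
Lemma mng_pullback (V : SmallType) (t u : simtype) (s : symbol -> symbol) (M : structure t)
    (phi : formula_algebra (fol_connectives V) (P_ V u))
    (psi : formula_algebra (fol_connectives V) (P_ V t)) :
  proj1_sig psi = rename s (proj1_sig phi) ->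
  fol_mng M psi = fol_mng (pullback u s M) phi /\
  (fol_valid M psi <-> fol_valid (pullback u s M) phi).
Proof.
  intro E.
  assert (K : forall k : V -> universe M,
             sat (proj1_sig psi) k <-> @sat V u (pullback u s M) (proj1_sig phi) k).
  { intro k; rewrite E; symmetry; apply sat_pullback, (proj2_sig phi). }
  split.
  - unfold fol_mng; simpl; f_equal; apply functional_extensionality; intro k.
    apply propositional_extensionality, K.
  - unfold fol_valid; simpl; split; intros H k; apply K, H.
Qed.

Lemma P_subset_arity (V : Type) (t u : simtype) :
  inhabited V -> subset (P_ V t) (P_ V u) -> preserves_arity t u (fun r => r).
Proof.
  intros [v] H r n E.
  specialize (H (r, repeat v n)); unfold P_ in H; simpl in H.
  rewrite repeat_length in H; auto.
Qed.

Lemma FOL_reduct (V : SmallType) (t u : simtype) (PQ : subset (P_ V t) (P_ V u)) :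
  inhabited V -> reduct PQ (FOL V t) (FOL V u).
Proof.
  intro iV; exists (pullback t (fun r => r)); split.
  (* For surjectivity, [M] is expanded by empty relations; the reduct of the expansion is [M]
     again. *)
  - intro M; exists (pullback u (fun r => r) M).
    apply pullback_cancel; [now apply (@P_subset_arity V) | intros r _; reflexivity].
  - intros M phi; apply mng_pullback; simpl; symmetry; apply rename_id.
Qed.

(** Formulas move forward along [s], so structures are pulled back along the inverse [s']. *)
Lemma FOL_isomorphic (V : SmallType) (t u : simtype) (s s' : symbol -> symbol) :
  preserves_arity t u s -> preserves_arity u t s' ->
  retraction t s s' -> retraction u s' s ->
  isomorphic (FOL V t) (FOL V u).
Proof.
  intros Hs Hs' Hr Hr'.
  exists (fun phi => exist (over (P_ V u)) (rename s (proj1_sig phi))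
                   (over_rename Hs (proj2_sig phi))), (pullback u s').
  split; [|split; [|split]].
  - intros c xs; now apply subset_eq_compat.
  - exists (fun phi => exist (over (P_ V t)) (rename s' (proj1_sig phi))
                   (over_rename Hs' (proj2_sig phi))).
    split; intros [phi H]; apply subset_eq_compat; now apply (rename_cancel (V := V)) with (2 := H).
  - exists (pullback t s); split; intro M; now apply pullback_cancel.
  - intros M phi; apply mng_pullback; simpl; symmetry.
    now apply (rename_cancel (V := V)) with (2 := proj2_sig phi).
Qed.

(** * Similarity types *)

Definition a_symbol : symbol := existT (fun A : SmallType => A) unit tt.

Lemma pushforward (t : simtype) (s : symbol -> symbol) :
  (forall r r', t r <> None -> t r' <> None -> s r = s r' -> r = r') ->
  exists (u : simtype) (s' : symbol -> symbol),
    preserves_arity t u s /\ preserves_arity u t s' /\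
    retraction t s s' /\ retraction u s' s.
Proof.
  intro inj.
  (* Outside the image of the domain [s'] takes an arbitrary value; the arity [a] defined below is
     [None] there. *)
  pose (s' := fun q => epsilon (inhabits a_symbol) (fun r => t r <> None /\ s r = q)).
  assert (Hs' : forall q, (exists r, t r <> None /\ s r = q) ->
                 t (s' q) <> None /\ s (s' q) = q).
  { intros q Hq; exact (epsilon_spec (inhabits a_symbol) _ Hq). }
  assert (K : retraction t s s').
  { intros r Hr; destruct (Hs' (s r)) as [H1 H2]; [now exists r | now apply inj]. }
  pose (a := fun q => if excluded_middle_informative (exists r, t r <> None /\ s r = q)
                      then t (s' q) else None).
  assert (a_s : forall r n, t r = Some n -> a (s r) = Some n).
  { intros r n E; unfold a; destruct (excluded_middle_informative _) as [_ | no].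
    - rewrite K; congruence.
    - exfalso; apply no; exists r; split; congruence. }
  assert (a_Some : forall q n, a q = Some n -> t (s' q) = Some n /\ s (s' q) = q).
  { intros q n; unfold a; destruct (excluded_middle_informative _) as [H | _]; [|discriminate].
    intro E; split; [exact E | now apply Hs']. }
  assert (a_None : forall q, a q <> None -> t (s' q) <> None /\ s (s' q) = q).
  { intros q Hq; destruct (a q) as [n|] eqn:E; [|congruence].
    apply a_Some in E as [E ->]; split; congruence. }
  unshelve eexists (Build_simtype (arity := a) _ _ _).
  - intros q n E; apply a_Some in E as [E _]; exact (arity_pos E).
  - destruct (dom_small t) as [D [f Hf]].
    exists D, (fun d => s (f d)); intro q; split.
    + intro Hq; apply a_None in Hq as [H1 H2].
      apply Hf in H1 as [d Hd]; exists d; now rewrite Hd.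
    + intros [d <-].
      assert (Hd : t (f d) <> None) by (apply Hf; now exists d).
      destruct (t (f d)) as [n|] eqn:E; [|congruence].
      rewrite (a_s _ _ E); discriminate.
  - destruct (dom_nonempty t) as [r Hr]; exists (s r).
    destruct (t r) as [n|] eqn:E; [|congruence].
    rewrite (a_s _ _ E); discriminate.
  - exists s'; repeat split.
    + exact a_s.
    + intros q n E; now apply a_Some.
    + exact K.
    + intros q Hq; now apply a_None.
Qed.

(** The indexing [f] of the domain may repeat; a code is one chosen index, and [f] recovers the
    symbol from it. A nonempty domain supplies the default [d0]. *)
Lemma domain_code (t : simtype) :
  exists (D : SmallType) (c : symbol -> D),
    forall r r', t r <> None -> t r' <> None -> c r = c r' -> r = r'.
Proof.
  destruct (dom_small t) as [D [f Hf]], (dom_nonempty t) as [r0 Hr0].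
  apply Hf in Hr0 as [d0 _].
  exists D, (fun r => epsilon (inhabits d0) (fun d => f d = r)).
  assert (K : forall r, t r <> None -> f (epsilon (inhabits d0) (fun d => f d = r)) = r).
  { intros r Hr; apply (epsilon_spec (inhabits d0) (fun d => f d = r)), Hf, Hr. }
  intros r r' Hr Hr' E; rewrite <- (K r Hr), <- (K r' Hr'), E; reflexivity.
Qed.

(** * Types outside a given set, and disjoint copies *)

Lemma cast_inj (A B : Type) (E : A = B) (x y : A) :
  eq_rect A (fun T => T) x B E = eq_rect A (fun T => T) y B E -> x = y.
Proof. destruct E; exact id. Qed.

(** The diagonal set collects the codes [k X] that do not belong to their own [X]. *)
Lemma cantor (S : Type) (k : (S -> Prop) -> S) : ~ Injective k.
Proof.
  intro inj.
  pose (D := fun x => exists X, k X = x /\ ~ X x).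
  assert (N : ~ D (k D)).
  { intros [X [E H]]; assert (X = D) by (now apply inj); subst X.
    apply H; exists D; auto. }
  apply N; exists D; auto.
Qed.

(** [T a] embeds in the sum; were it equal to the power set of the sum, that power set would inject
    into the sum. The summand [D] leaves room for codes of symbols. *)
Lemma new_type (A : SmallType) (T : A -> SmallType) (D : SmallType) (a : A) :
  T a <> (({a : A & T a} + D)%type -> Prop).
Proof.
  intro E.
  apply (@cantor ({a : A & T a} + D)
    (fun X => inl (existT T a (eq_rect _ (fun T => T) X _ (eq_sym E))))).
  intros X Y H; injection H as H.
  apply inj_pair2 in H; now apply cast_inj in H.
Qed.

Lemma FOL_copy (V : SmallType) (t : simtype) (H : fol_atom V -> Prop) :
  small H ->
  exists u : simtype, disjoint (P_ V u) H /\ isomorphic (FOL V t) (FOL V u).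
Proof.
  intros [A [f Hf]].
  destruct (domain_code t) as [D [c Hc]].
  pose (T := fun a : A => projT1 (fst (f a))).
  pose (B := ({a : A & T a} + D)%type -> Prop).
  (* The new symbols are the singletons of the codes, taken as elements of [B]. *)
  pose (s := fun r => existT (fun A : SmallType => A) B (fun x => x = inr (c r))).
  destruct (@pushforward t s) as [u [s' [H1 [H2 [H3 H4]]]]].
  { intros r r' Hr Hr' E; apply Hc; auto.
    apply inj_pair2 in E; assert (E' := f_equal (fun X => X (inr (c r))) E).
    simpl in E'; assert (K : @inr {a : A & T a} D (c r) = inr (c r')).
    { rewrite <- E'; reflexivity. }
    now injection K. }
  exists u; split; [|now apply FOL_isomorphic with s s'].
  intros [q vs] [Pq Hq]; apply Hf in Hq as [a Ha].
  (* A symbol of [u] is a value of [s], so its type is [B]; occurring in [H], it also has type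
     [T a]. *)
  assert (E : s (s' q) = q).
  { apply H4; unfold P_ in Pq; simpl in Pq; congruence. }
  apply (@new_type A T D a); unfold T at 1; rewrite Ha; simpl.
  now rewrite <- E.
Qed.

Lemma union_simtype (V : Type) (I : SmallType) (ti : I -> simtype) :
  inhabited V -> inhabited I ->
  (forall i j r, ti i r <> None -> ti j r <> None -> i = j) ->
  exists u : simtype, P_ V u = union (fun i => P_ V (ti i)).
Proof.
  intros [v] [i0] dis.
  (* The arity is read in a chosen summand; disjointness makes the choice immaterial. *)
  pose (a := fun r => match excluded_middle_informative (exists i, ti i r <> None) with
                      | left H => ti (proj1_sig (constructive_indefinite_description _ H)) r
                      | right _ => None
                      end).
  assert (Ha : forall r n, a r = Some n <-> exists i, ti i r = Some n).
  { intros r n; unfold a; destruct (excluded_middle_informative _) as [H | H].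
    - destruct (constructive_indefinite_description _ H) as [i Hi]; simpl.
      split; [now exists i|]; intros [j Hj].
      now rewrite (dis i j r) by congruence.
    - split; [discriminate|]; intros [j Hj]; exfalso; apply H; exists j; congruence. }
  assert (Ha' : forall r, a r <> None <-> exists i, ti i r <> None).
  { intro r; split.
    - intro H; destruct (a r) as [n|] eqn:E; [|congruence].
      apply Ha in E as [i E]; exists i; congruence.
    - intros [i H]; destruct (ti i r) as [n|] eqn:E; [|congruence].
      assert (E' : a r = Some n) by (apply Ha; now exists i); congruence. }
  unshelve eexists (Build_simtype (arity := a) _ _ _).
  - intros r n E; apply Ha in E as [i E]; exact (arity_pos E).
  - assert (S : forall i, {D : {D : SmallType & D -> symbol} |
                 forall r, ti i r <> None <-> exists d, projT2 D d = r}).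
    { intro i; apply constructive_indefinite_description.
      destruct (dom_small (ti i)) as [D [f Hf]].
      now exists (existT (fun D : SmallType => D -> symbol) D f). }
    exists {i : I & projT1 (proj1_sig (S i))},
      (fun p => projT2 (proj1_sig (S (projT1 p))) (projT2 p)).
    intro r; rewrite Ha'; split.
    + intros [i Hi]; apply (proj2_sig (S i)) in Hi as [d Hd].
      now exists (existT (fun i => projT1 (proj1_sig (S i))) i d).
    + intros [[i d] Hd]; exists i; apply (proj2_sig (S i)); now exists d.
  - destruct (dom_nonempty (ti i0)) as [r Hr]; exists r; apply Ha'; now exists i0.
  - apply functional_extensionality; intros [r vs].
    apply propositional_extensionality; exact (Ha r (length vs)).
Qed.

Lemma FOL_copies (V : SmallType) (I : SmallType) (ti : I -> simtype) :
  inhabited V -> inhabited I ->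
  exists ui : I -> simtype,
    pairwise_disjoint (fun i => P_ V (ui i)) /\
    (forall i, isomorphic (FOL V (ti i)) (FOL V (ui i))) /\
    exists u : simtype, P_ V u = union (fun i => P_ V (ui i)).
Proof.
  intros iV iI.
  assert (S : forall i, {D : {D : SmallType & symbol -> D} |
     forall r r', ti i r <> None -> ti i r' <> None ->
       projT2 D r = projT2 D r' -> r = r'}).
  { intro i; apply constructive_indefinite_description.
    destruct (domain_code (ti i)) as [D [c Hc]].
    now exists (existT (fun D : SmallType => symbol -> D) D c). }
  (* A new symbol is the code of the old one tagged with its index [i]; all of them live in the
     single type [E]. *)
  pose (E := {i : I & projT1 (proj1_sig (S i))}).
  pose (s := fun i r => existT (fun A : SmallType => A) E
    (existT (fun i => projT1 (proj1_sig (S i))) i (projT2 (proj1_sig (S i)) r))).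
  assert (K : forall i, {u : simtype | exists s',
    preserves_arity (ti i) u (s i) /\ preserves_arity u (ti i) s' /\
    retraction (ti i) (s i) s' /\ retraction u s' (s i)}).
  { intro i; apply constructive_indefinite_description, pushforward.
    intros r r' Hr Hr' H; apply inj_pair2, inj_pair2 in H.
    now apply (proj2_sig (S i)). }
  pose (ui := fun i => proj1_sig (K i)).
  assert (dis : forall i j r, ui i r <> None -> ui j r <> None -> i = j).
  { intros i j r Hi Hj.
    destruct (proj2_sig (K i)) as [si [_ [_ [_ Ri]]]], (proj2_sig (K j)) as [sj [_ [_ [_ Rj]]]].
    (* A common symbol would carry both tags, so the tags coincide. *)
    assert (Q : s i (si r) = s j (sj r)) by (rewrite Ri, Rj; auto).
    apply inj_pair2 in Q; exact (f_equal (@projT1 _ _) Q). }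
  exists ui; split; [|split].
  - intros i j ij [r vs] [Hi Hj]; apply ij; unfold P_ in *; simpl in *.
    apply (dis i j r); congruence.
  - intro i; destruct (proj2_sig (K i)) as [s' [H1 [H2 [H3 H4]]]].
    now apply FOL_isomorphic with (s i) s'.
  - now apply union_simtype.
Qed.

Lemma P_small (V : SmallType) (t : simtype) : small (P_ V t).
Proof.
  destruct (dom_small t) as [D [f Hf]].
  exists {p : D * list V | P_ V t (f (fst p), snd p)},
    (fun p => (f (fst (proj1_sig p)), snd (proj1_sig p))).
  intros [r vs]; split.
  - intro H; assert (Hr : t r <> None) by (unfold P_ in H; simpl in H; congruence).
    apply Hf in Hr as [d <-].
    now exists (exist (fun p : D * list V => P_ V t (f (fst p), snd p)) (d, vs) H).
  - intros [[[d ws] H] E]; simpl in *; now rewrite <- E.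
Qed.

Lemma unary_simtype : exists t : simtype, t a_symbol = Some 1.
Proof.
  pose (a := fun r => if excluded_middle_informative (r = a_symbol) then Some 1 else None).
  assert (E : a a_symbol = Some 1).
  { unfold a; destruct (excluded_middle_informative _); congruence. }
  unshelve eexists (Build_simtype (arity := a) _ _ _); [| | |exact E].
  - intros r n; unfold a; destruct (excluded_middle_informative _); [|discriminate].
    intro H; injection H as <-; constructor.
  - exists unit, (fun _ => a_symbol); intro r; split.
    + unfold a; destruct (excluded_middle_informative _) as [-> | _]; [now exists tt | easy].
    + intros [_ <-]; congruence.
  - exists a_symbol; congruence.
Qed.

Lemma FOL_Sig_P_ (V : SmallType) (t : simtype) : FOL_Sig (P_ V t).
Proof. now exists t. Qed.

Lemma taut_congr_FOL_family (V : SmallType) (t : simtype) (S : FOL_Sig (P_ V t))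
    (x y : formula_algebra (fol_connectives V) (P_ V t)) :
  inhabited V -> (taut_congr (FOL_family V _ S) x y <-> equivalent x y).
Proof.
  intro iV; rewrite FOL_family_P_ by exact iV.
  split; intros H M; apply fol_mng_eq, H.
Qed.

(** * The logic family *)

(** Stated for a variable [Q] covered by the [Pi] instead of their literal union, so that [Q] can be
    replaced by [P_ V t]. *)
Lemma FOL_family_union (V : SmallType) (I : Type) (Pi : I -> fol_atom V -> Prop)
    (SPi : forall i, FOL_Sig (Pi i)) (Q : fol_atom V -> Prop) (SQ : FOL_Sig Q)
    (sub : forall i, subset (Pi i) Q) :
  ~ Finite V -> (forall a, Q a -> exists i, Pi i a) ->
  forall phi psi : formula_algebra (fol_connectives V) Q,
    taut_congr (FOL_family V Q SQ) phi psi <->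
    forall (A : algebra (fol_connectives V)) (h : formula_algebra (fol_connectives V) Q -> A),
      Alg_m (FOL_family V Q SQ) A -> is_hom h ->
      (forall i (x y : formula_algebra (fol_connectives V) (Pi i)),
          taut_congr (FOL_family V (Pi i) (SPi i)) x y ->
          h (formula_incl (sub i) x) = h (formula_incl (sub i) y)) ->
      h phi = h psi.
Proof.
  intros inf cover phi psi.
  assert (iV := infinite_inhabited inf).
  assert (T : exists ti, Pi = fun i => P_ V (ti i)).
  { exists (fun i => proj1_sig (constructive_indefinite_description _ (SPi i))).
    apply functional_extensionality; intro i.
    now destruct (constructive_indefinite_description _ (SPi i)). }
  destruct T as [ti ->].
  assert (SQ' := SQ); destruct SQ' as [t <-].
  rewrite taut_congr_FOL_family, FOL_family_P_ by exact iV; split.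
  - intros Hphi A h HA Hh Heq.
    apply (@FOL_union V t I ti sub cover inf phi psi A h); auto.
    intros i x y E; apply Heq; now apply taut_congr_FOL_family.
  - intros H M; apply fol_mng_eq.
    (* The hypothesis is applied to the meaning homomorphism of [M]. It respects the tautologies of
       a summand because it agrees there with the meaning function of a reduct of [M]. *)
    assert (E : to_image (fol_mng M) phi = to_image (fol_mng M) psi).
    { apply (H (image_algebra (@fol_mng V t M))).
      - now exists M.
      - apply to_image_hom, fol_mng_compositional.
      - intros i x y E; apply subset_eq_compat.
        destruct (FOL_reduct (@sub i) iV) as [g [_ Hg]].
        etransitivity; [exact (proj1 (Hg M x))|].
        symmetry; etransitivity; [exact (proj1 (Hg M y))|].
        symmetry; apply fol_mng_eq.
        apply taut_congr_FOL_family in E; [apply E | exact iV]. }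
    exact (f_equal (@proj1_sig _ _) E).
Qed.

Theorem theorem5p3 (V : SmallType) (infinite_V : ~ Finite V) :
  logic_family (FOL_family V).
Proof.
  assert (iV := infinite_inhabited infinite_V).
  constructor.
  - intros P [t <-]; apply P_small.
  - intros P Q SP SQ PQ.
    assert (SP' := SP); assert (SQ' := SQ); destruct SP' as [t <-], SQ' as [u <-].
    rewrite !FOL_family_P_ by exact iV; now apply FOL_reduct.
  - intros I Pi SPi SP _; now apply FOL_family_union.
  - intros P SP H HH; assert (SP' := SP); destruct SP' as [t <-].
    destruct (@FOL_copy V t H HH) as [u [D E]].
    exists (P_ V u), (FOL_Sig_P_ V u); split; [exact D|].
    now rewrite !FOL_family_P_.
  - intros I Pi SPi iI.
    pose (ti := fun i => proj1_sig (constructive_indefinite_description _ (SPi i))).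
    destruct (@FOL_copies V I ti iV iI) as [ui [D [E Su]]].
    exists (fun i => P_ V (ui i)), (fun i => FOL_Sig_P_ V (ui i)).
    split; [exact D | split; [|exact Su]].
    intro i; rewrite (FOL_family_P_ (FOL_Sig_P_ V (ui i)) iV).
    specialize (E i); unfold ti in E.
    destruct (constructive_indefinite_description _ (SPi i)) as [t Et]; simpl in E.
    (* Generalising the proof [SPi i] allows [Pi i] to be replaced by [P_ V t] in its type. *)
    revert E; generalize (SPi i); destruct Et; intros S E.
    now rewrite FOL_family_P_.
  - destruct unary_simtype as [t Ht], iV as [v].
    exists (P_ V t); split; [now exists t | now exists (a_symbol, [v])].
Qed.
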